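(* Let $\Omega\subset\mathbb{R}^N$ be an open bounded set, $q\in L^\infty(\Omega;\mathbb{R}^N)$ and $s\in(0,1)$. Let $u\in\mathcal{L}^1_s(\mathbb{R}^N)\cap\mathcal{C}^2(\Omega)\cap\mathcal{C}(\mathbb{R}^N)$ satisfy $$-\Delta u+(-\Delta)^s u+q\cdot\nabla u\ge0\ \text{ in }\Omega,\qquad u\ge0\ \text{ on }\mathbb{R}^N\setminus\Omega.$$ Then either $u>0$ in $\Omega$ or $u\equiv0$ in $\mathbb{R}^N$.
   Context: The fractional Laplacian is $(-\Delta)^s u(x)=C_{N,s}\lim_{\varepsilon\to0^+}\int_{\mathbb{R}^N\setminus B_\varepsilon(x)}\frac{u(x)-u(y)}{|x-y|^{N+2s}}\,dy$, with $C_{N,s}=\pi^{-N/2}2^{2s}s\,\Gamma(\frac N2+s)/\Gamma(1-s)$. $\mathcal{L}^1_s(\mathbb{R}^N)$ is the space of measurable $u:\mathbb{R}^N\to\mathbb{R}$ with $\int_{\mathbb{R}^N}\frac{|u(y)|}{1+|y|^{N+2s}}\,dy<\infty$. *)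

(* Defs.v *)
From HB Require Import structures.
From mathcomp Require Import all_boot all_order all_algebra.
From mathcomp Require Import all_classical all_reals all_analysis.
Set Implicit Arguments. Unset Strict Implicit. Unset Printing Implicit Defensive.
Import Order.TTheory GRing.Theory Num.Theory.
Import numFieldNormedType.Exports.
Local Open Scope classical_set_scope.
Local Open Scope ring_scope.

Section Defs.
Variable R : realType.

(* R^N is modelled by row vectors 'rV[R]_N (product topology = Euclidean topology). *)

(* Euclidean norm |x| on R^N (the library norm on matrices is the sup norm). *)
Definition enorm (N : nat) (x : 'rV[R]_N) : R :=
  Num.sqrt (\sum_(i < N) (x ord0 i) ^+ 2).

Definition ebounded (N : nat) (A : set 'rV[R]_N) : Prop :=
  exists M : R, forall x, A x -> enorm x <= M.

Definition rvcons (n : nat) (t : R) (v : 'rV[R]_n) : 'rV[R]_n.+1 :=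
  \row_(i < n.+1) (if unlift ord0 i is Some j then v ord0 j else t).

(* Lebesgue integral over R^n of a NONNEGATIVE function, realized as the
   iterated one-dimensional Lebesgue integral (equal to the integral for the
   n-dimensional Lebesgue measure by Tonelli's theorem). *)
Fixpoint iint (n : nat) : ('rV[R]_n -> \bar R) -> \bar R :=
  match n return ('rV[R]_n -> \bar R) -> \bar R with
  | 0 => fun f => f 0
  | m.+1 => fun f =>
      (\int[@lebesgue_measure R]_(t in [set: R]) iint (fun v => f (rvcons t v)))%E
  end.

Definition rn_integral (N : nat) (g : 'rV[R]_N -> R) : R :=
  fine (iint (fun y => (Num.max (g y) 0)%:E)) -
  fine (iint (fun y => (Num.max (- g y) 0)%:E)).

Definition rn_borel (N : nat) (A : set 'rV[R]_N) : Prop :=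
  smallest (sigma_algebra setT) (@open 'rV[R]_N) A.

Definition rn_null (N : nat) (A : set 'rV[R]_N) : Prop :=
  exists B, rn_borel B /\ A `<=` B /\
    iint (fun y => (\1_B y)%:E) = 0%E.

Definition rn_lmeas (N : nat) (A : set 'rV[R]_N) : Prop :=
  exists B, rn_borel B /\ rn_null ((A `\` B) `|` (B `\` A)).

Definition Linfty_on (N : nat) (Om : set 'rV[R]_N) (q : 'rV[R]_N -> 'rV[R]_N) : Prop :=
  (forall (i : 'I_N) (O : set R), open O ->
     rn_lmeas [set x | Om x /\ O (q x ord0 i)]) /\
  exists M : R, rn_null [set x | Om x /\ M < enorm (q x)].

Definition L1s (N : nat) (s : R) (u : 'rV[R]_N -> R) : Prop :=
  (iint (fun y => (`|u y| / (1 + enorm y `^ (N%:R + 2 * s)))%:E) < +oo)%E.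

Definition evec (N : nat) (i : 'I_N) : 'rV[R]_N := delta_mx ord0 i.

Definition pderiv (N : nat) (i : 'I_N) (f : 'rV[R]_N -> R) : 'rV[R]_N -> R :=
  fun x => derive f x (evec i).

Definition C2_on (N : nat) (Om : set 'rV[R]_N) (u : 'rV[R]_N -> R) : Prop :=
  forall x, Om x ->
    {for x, continuous u} /\
    forall i j : 'I_N,
      derivable u x (evec i) /\ {for x, continuous (pderiv i u)} /\
      derivable (pderiv i u) x (evec j) /\
      {for x, continuous (pderiv j (pderiv i u))}.

Definition laplacian (N : nat) (u : 'rV[R]_N -> R) (x : 'rV[R]_N) : R :=
  \sum_(i < N) pderiv i (pderiv i u) x.

Definition qdotgrad (N : nat) (q : 'rV[R]_N -> 'rV[R]_N) (u : 'rV[R]_N -> R)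
  (x : 'rV[R]_N) : R :=
  \sum_(i < N) q x ord0 i * pderiv i u x.

Definition Gamma (z : R) : R :=
  fine (\int[@lebesgue_measure R]_(t in [set t : R | (0 < t)%R])
          ((t `^ (z - 1) * expR (- t))%R)%:E)%E.

Definition CNs (N : nat) (s : R) : R :=
  pi `^ (- (N%:R / 2)) * 2 `^ (2 * s) * s * Gamma (N%:R / 2 + s) / Gamma (1 - s).

Definition fraclap_trunc (N : nat) (s : R) (u : 'rV[R]_N -> R) (x : 'rV[R]_N)
  (eps : R) : R :=
  rn_integral (fun y => if eps <= enorm (x - y)
                        then (u x - u y) / enorm (x - y) `^ (N%:R + 2 * s)
                        else 0).

Definition fraclap (N : nat) (s : R) (u : 'rV[R]_N -> R) (x : 'rV[R]_N) : R :=
  CNs N s * lim (fraclap_trunc s u x @ 0^'+).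

End Defs.

(* Main.v *)
(** At a global minimum point [x] of [u] inside [Om] with [u x <= 0] (which
    exists as soon as [u > 0] fails somewhere in [Om]) the gradient vanishes,
    which kills the drift whatever [q] is, and the pure second derivatives are
    nonnegative, so the inequality at [x] forces [fraclap s u x >= 0].  The
    truncated integrals of [(u y - u x) / |x - y|^(N + 2 s)] increase as the
    truncation radius decreases to 0.  They are bounded, because [u] grows at
    most quadratically near [x] and lies in [L1s], hence they converge; if
    [u y > u x] for some [y] the limit is positive and [fraclap s u x < 0].
    Hence [u] is constant, and its value is 0 since [Om] is bounded.

    All radial majorants are replaced by products of one-variable functions of
    the coordinates, using [|x - y| >= |x_i - y_i|], because the integral over
    R^N is an iterated one-dimensional integral. *)

Require Import Defs.
From HB Require Import structures.
From mathcomp Require Import all_boot all_order all_algebra.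
From mathcomp Require Import all_classical all_reals all_analysis.
From mathcomp Require Import measurable_realfun ring lra.
Import Order.TTheory GRing.Theory Num.Theory.
Import numFieldNormedType.Exports.
Local Open Scope classical_set_scope.
Local Open Scope ring_scope.

Set Implicit Arguments. Unset Strict Implicit. Unset Printing Implicit Defensive.

(** * Iterated integrals *)

(* 'rV[R]_n carries no measurable structure here: a function of n real
   variables is called measurable when it sends measurable coordinates,
   over any measurable space, to a measurable function. *)
Definition rv_measurable (R : realType) n (f : 'rV[R]_n -> \bar R) : Prop :=
  forall d (T : measurableType d) (c : 'I_n -> T -> R),
    (forall i, measurable_fun [set: T] (c i)) ->
    measurable_fun [set: T] (fun t => f (\row_i c i t)).

(** Joint measurability in a parameter and the coordinates: the form that survives induction on the
    dimension, where coordinates pass one by one into the parameter space. *)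
Definition param_measurable (R : realType) n d0 (T0 : measurableType d0)
    (F : T0 -> 'rV[R]_n -> \bar R) : Prop :=
  forall d (T : measurableType d) (p : T -> T0) (c : 'I_n -> T -> R),
    measurable_fun [set: T] p ->
    (forall i, measurable_fun [set: T] (c i)) ->
    measurable_fun [set: T] (fun t => F (p t) (\row_i c i t)).

Section IteratedIntegral.
Variable R : realType.
Local Notation mu := (@lebesgue_measure R).

Lemma rvcons_row n (t : R) (c : 'I_n -> R) :
  rvcons t (\row_i c i) =
  \row_(i < n.+1) (if unlift ord0 i is Some j then c j else t).
Proof. by apply/rowP => i; rewrite !mxE; case: unlift => [j|] //; rewrite mxE. Qed.

Lemma rvcons0 n (t : R) (v : 'rV[R]_n) : rvcons t v ord0 ord0 = t.
Proof. by rewrite mxE unlift_none. Qed.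

Lemma rvconsS n (t : R) (v : 'rV[R]_n) i :
  rvcons t v ord0 (lift ord0 i) = v ord0 i.
Proof. by rewrite mxE liftK. Qed.

Lemma param_measurable_slice n (f : 'rV[R]_n.+1 -> \bar R) :
  rv_measurable f -> param_measurable (fun (t : R) v => f (rvcons t v)).
Proof.
move=> mf d T p c mp mc.
under eq_fun do rewrite rvcons_row.
apply: (mf _ _ (fun i t => if unlift ord0 i is Some j then c j t else p t)).
by move=> i; case: unlift.
Qed.

Lemma rv_measurable_slice n (f : 'rV[R]_n.+1 -> \bar R) t :
  rv_measurable f -> rv_measurable (fun v => f (rvcons t v)).
Proof.
move=> mf d T c mc.
by apply: (@param_measurable_slice _ f mf _ _ (cst t) c) => //; exact: measurable_cst.
Qed.

Lemma iint_ge0 n (f : 'rV[R]_n -> \bar R) :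
  (forall x, 0 <= f x)%E -> (0 <= iint f)%E.
Proof.
elim: n f => [|n IH] f f0 /=; first exact: f0.
by apply: integral_ge0 => t _; apply: IH.
Qed.

(** Induction on [n] over all parameter spaces: the first coordinate joins the parameter, the
    induction hypothesis gives measurability on [T0 * R], and Tonelli's theorem integrates that
    coordinate out. *)
Lemma measurable_iint n d0 (T0 : measurableType d0)
    (F : T0 -> 'rV[R]_n -> \bar R) :
  param_measurable F -> (forall t x, 0 <= F t x)%E ->
  measurable_fun [set: T0] (fun t => iint (F t)).
Proof.
elim: n d0 T0 F => [|n IH] d0 T0 F mF F0 /=.
  have := @mF _ _ id (fun i : 'I_0 => cst 0) (@measurable_id _ _ _).
  rewrite /= => mF'; apply: eq_measurable_fun (mF' _) => [t _|i].
    by congr (F t _); apply/rowP => -[].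
  exact: measurable_cst.
pose G (z : T0 * R) := iint (fun v => F z.1 (rvcons z.2 v)).
apply: (@measurable_fun_fubini_tonelli_F _ _ _ _ _ mu G).
  apply: IH => // d T p c mp mc.
  under eq_fun do rewrite rvcons_row.
  apply: (mF _ _ (fst \o p)
    (fun i t => if unlift ord0 i is Some j then c j t else (p t).2)).
    exact: measurableT_comp.
  move=> i; case: unlift => [j|]; first exact: mc.
  exact: (measurableT_comp measurable_snd).
by move=> z; exact: iint_ge0.
Qed.

Lemma measurable_iint_slice n (f : 'rV[R]_n.+1 -> \bar R) :
  rv_measurable f -> (forall x, 0 <= f x)%E ->
  measurable_fun [set: R] (fun t => iint (fun v => f (rvcons t v))).
Proof.
move=> mf f0; apply: measurable_iint => //; exact: param_measurable_slice.
Qed.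

(* The exceptional hyperplanes [y_i = x_i] are null; singular majorants take
   junk values on them, since [powR 0 (- a) = 0] for [a != 0]. *)
Lemma iint_le n (x : 'rV[R]_n) (f g : 'rV[R]_n -> \bar R) :
  rv_measurable f -> rv_measurable g ->
  (forall y, 0 <= f y)%E -> (forall y, 0 <= g y)%E ->
  (forall y : 'rV[R]_n, (forall i, y ord0 i != x ord0 i) -> f y <= g y)%E ->
  (iint f <= iint g)%E.
Proof.
elim: n x f g => [|n IH] x f g mf mg f0 g0 fg /=; first by apply: fg => -[].
apply: ae_ge0_le_integral => //.
- by move=> t _; apply: iint_ge0.
- exact: measurable_iint_slice.
- by move=> t _; apply: iint_ge0.
- exact: measurable_iint_slice.
exists [set x ord0 ord0]; split; first exact: measurable_set1.
  exact: lebesgue_measure_set1.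
move=> t /=; apply: contra_notP => /eqP tx _.
apply: (IH (\row_i x ord0 (lift ord0 i))) => //; try exact: rv_measurable_slice.
move=> v vx; apply: fg => i.
case: (unliftP ord0 i) => [j|] ->; last by rewrite rvcons0.
by rewrite rvconsS; have := vx j; rewrite mxE.
Qed.

Lemma iintD n (f g : 'rV[R]_n -> \bar R) :
  rv_measurable f -> rv_measurable g ->
  (forall y, 0 <= f y)%E -> (forall y, 0 <= g y)%E ->
  iint (fun y => f y + g y)%E = (iint f + iint g)%E.
Proof.
elim: n f g => [|n IH] f g mf mg f0 g0 //=.
rewrite -ge0_integralD //.
- by apply: eq_integral => t _; rewrite IH //; exact: rv_measurable_slice.
- by move=> t _; apply: iint_ge0.
- exact: measurable_iint_slice.
- by move=> t _; apply: iint_ge0.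
- exact: measurable_iint_slice.
Qed.

Lemma iintZl n (c : R) (f : 'rV[R]_n -> \bar R) :
  rv_measurable f -> (forall y, 0 <= f y)%E -> 0 <= c ->
  iint (fun y => c%:E * f y)%E = (c%:E * iint f)%E.
Proof.
elim: n f => [|n IH] f mf f0 c0 //=.
rewrite -ge0_integralZl_EFin //.
- by apply: eq_integral => t _; rewrite IH //; exact: rv_measurable_slice.
- by move=> t _; apply: iint_ge0.
- exact: measurable_iint_slice.
Qed.

(** The constant [c] is carried along because, in the induction, it absorbs the factor of the
    coordinate already fixed. *)
Lemma iint_prod n (c : R) (h : 'I_n -> R -> R) (I : 'I_n -> R) : 0 <= c ->
  (forall i, measurable_fun [set: R] (h i)) -> (forall i t, 0 <= h i t) ->
  (forall i, \int[mu]_(t in [set: R]) (h i t)%:E = (I i)%:E)%E ->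
  iint (fun y : 'rV[R]_n => (c * \prod_(i < n) h i (y ord0 i))%:E) =
  (c * \prod_(i < n) I i)%:E.
Proof.
elim: n c h I => [|n IH] c h I c0 mh h0 hI /=; first by rewrite !big_ord0.
transitivity (\int[mu]_(t in [set: R])
    ((c * \prod_(i < n) I (lift ord0 i))%:E * (h ord0 t)%:E))%E.
  apply: eq_integral => t _.
  rewrite -EFinM [_ * h ord0 t]mulrAC -(IH _ (fun i => h (lift ord0 i))) //.
    congr iint; apply/funext => v; rewrite big_ord_recl rvcons0 mulrA.
    by under eq_bigr do rewrite rvconsS.
  by rewrite mulr_ge0.
rewrite ge0_integralZl_EFin //.
- rewrite hI -EFinM big_ord_recl; congr (_%:E); ring.
- by move=> t _; rewrite lee_fin.
- by apply/measurable_EFinP; exact: mh.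
- rewrite mulr_ge0 // prodr_ge0 // => i _.
  by rewrite -lee_fin -hI integral_ge0 // => t _; rewrite lee_fin.
Qed.

End IteratedIntegral.

(** * The sup norm on row vectors, and measurability of continuous functions *)

Section RowVectors.
Variable R : realType.

Lemma rvnorm_ge n (x : 'rV[R]_n) i : `|x ord0 i| <= `|x|.
Proof.
rewrite [leRHS]/Num.norm /= mx_normrE.
exact: (le_bigmax _ (fun ij : 'I_1 * 'I_n => `|x ij.1 ij.2|) (ord0, i)).
Qed.

Lemma rvnorm_le n (x : 'rV[R]_n) r :
  0 <= r -> (forall i, `|x ord0 i| <= r) -> `|x| <= r.
Proof.
move=> r0 xr; rewrite [leLHS]/Num.norm /= mx_normrE.
by apply/bigmax_leP; split => // -[i j] _ /=; rewrite ord1; exact: xr.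
Qed.

(** The composite is the pointwise limit of [u] evaluated at the coordinates rounded down to
    multiples of 1/(k+1). Each approximant factors through the countable type of integer vectors,
    and the level sets of [g k] are finite intersections of preimages of intervals. *)
Lemma continuous_rv_measurable n (u : 'rV[R]_n -> R) d (T : measurableType d)
    (c : 'I_n -> T -> R) :
  continuous u -> (forall i, measurable_fun [set: T] (c i)) ->
  measurable_fun [set: T] (fun t => u (\row_i c i t)).
Proof.
move=> cu mc.
pose g (k : nat) t : 'rV[int]_n := \row_i Num.floor (k.+1%:R * c i t).
pose v (k : nat) (z : 'rV[int]_n) := u (\row_i ((z ord0 i)%:~R / k.+1%:R)).
apply: (@measurable_fun_cvg _ _ _ _ (fun k t => v k (g k t))).
  move=> k _ Y mY; rewrite setTI.
  pose F (z : 'rV[int]_n) := if `[< Y (v k z) >] then [set t | g k t = z] else set0.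
  have -> : (fun t => v k (g k t)) @^-1` Y = \bigcup_z F z.
    apply/seteqP; split => [t /= Yt|t [z _]].
      by exists (g k t) => //; rewrite /F; case: asboolP.
    by rewrite /F; case: asboolP => //= Yz ->.
  apply: countable_bigcupT_measurable; first exact: countableP.
  move=> z; rewrite /F; case: asboolP => // _.
  have -> : [set t | g k t = z] =
      \bigcap_(i in [set: 'I_n])
        ((fun t => k.+1%:R * c i t) @^-1`
          `[(z ord0 i)%:~R, (z ord0 i + 1)%:~R[).
    apply/seteqP; split => t /=.
      by move=> <- i _; rewrite /g /= mxE in_itv /= floor_itv.
    move=> h; apply/rowP => i; rewrite mxE; apply: floor_def.
    by have := h i I; rewrite /= in_itv.
  apply: fin_bigcap_measurable => // i _.
  rewrite -[X in measurable X]setTI.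
  by apply: measurable_funM => //; exact: measurable_cst.
move=> t _; rewrite /v /=.
suff cg : \row_i ((g k t ord0 i)%:~R / k.+1%:R) @[k --> \oo] --> \row_i c i t.
  exact: (cvg_comp _ _ cg (cu _)).
apply/cvgrPdist_le => e e0.
near=> k; apply: rvnorm_le; first exact: ltW.
move=> i; rewrite /g !mxE.
have k0 : (0 < k.+1%:R :> R) by rewrite ltr0n.
have /andP[h1 h2] := floor_itv (k.+1%:R * c i t).
rewrite -(ler_pM2l k0) -{1}(gtr0_norm k0) -normrM mulrBr mulrCA divff ?gt_eqF//.
rewrite mulr1 ger0_norm ?subr_ge0 //.
apply: (@le_trans _ _ 1).
  by rewrite lerBlDl; move: h2; rewrite intrD => /ltW.
rewrite -ler_pdivrMl // mulr1.
near: k; apply: filterS (near_infty_natSinv_lt (PosNum e0)) => k /=.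
exact: ltW.
Unshelve. all: by end_near. Qed.

End RowVectors.

(** * One-variable majorant *)

Section Profile.
Variable R : realType.
Local Notation mu := (@lebesgue_measure R).

(** At every point a single term of the series of weighted indicators already dominates [f], and the
    integrals of the terms form a geometric series of ratio [z]. *)
Lemma integral_layers_lty (f : R -> R) (x A z : R) (c r : nat -> R) :
  measurable_fun [set: R] f -> (forall t, 0 <= f t) ->
  (forall k, 0 <= c k) -> (forall k, 0 <= r k) ->
  0 <= z < 1 -> (forall k, c k * (2 * r k) = A * z ^+ k) ->
  (forall t, 0 < f t -> exists k, `|t - x| <= r k /\ f t <= c k) ->
  (\int[mu]_(t in [set: R]) (f t)%:E < +oo)%E.
Proof.
move=> mf f0 c0 r0 /andP[z0 z1] crE fc.
pose B k : set R := `[x - r k, x + r k]%classic.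
pose g k t : \bar R := ((c k)%:E * (\1_(B k) t)%:E)%E.
have mB k : measurable (B k) by exact: measurable_itv.
have g0 k t : (0 <= g k t)%E by rewrite mule_ge0 // lee_fin.
have mg k : measurable_fun [set: R] (g k).
  apply: measurable_funeM; apply/measurable_EFinP; apply: measurable_indic; exact: mB.
have intg k : (\int[mu]_(t in [set: R]) g k t = (A * z ^+ k)%:E)%E.
  rewrite ge0_integralZl_EFin //; last first.
    by apply/measurable_EFinP; apply: measurable_indic; exact: mB.
  rewrite integral_indic; [|exact: measurableT|exact: mB].
  rewrite setIT /B /= lebesgue_measure_itv /= lte_fin.
  rewrite -crE; case: ifPn => [_|].
    by rewrite -EFinD -EFinM; congr (_%:E); ring.
  rewrite -leNgt => h; have -> : r k = 0 by apply/eqP; rewrite eq_le r0 andbT; lra.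
  by rewrite !mulr0 mule0.
have le_sum : (\int[mu]_(t in [set: R]) (f t)%:E <=
    \int[mu]_(t in [set: R]) (\sum_(k <oo) g k t))%E.
  apply: ge0_le_integral => //.
  - by move=> t _; rewrite lee_fin.
  - exact/measurable_EFinP.
  - by apply: (@ge0_emeasurable_sum _ _ R setT g xpredT).
  - move=> t _; have [ft|] := ltP 0 (f t); last first.
      by move=> ft; apply: (@le_trans _ _ 0%E); [rewrite lee_fin|exact: nneseries_ge0].
    have [j [tj fj]] := fc t ft.
    apply: (@le_trans _ _ (g j t)).
      rewrite /g -EFinM lee_fin indicE mem_set ?mulr1 //.
      by rewrite /B /= in_itv /=; move: tj; rewrite ler_distl.
    apply: (le_trans _ (nneseries_lim_ge j.+1 _)) => //.
    by rewrite big_nat_recr //= leeDr // sume_ge0.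
apply: (le_lt_trans le_sum); rewrite integral_nneseries //.
under eq_eseriesr do rewrite intg.
suff -> : (\sum_(k <oo) (A * z ^+ k)%:E = (A / (1 - z))%:E)%E by rewrite ltry.
apply/cvg_lim => //.
apply: cvg_EFin; first by apply: nearW => n; rewrite sumEFin.
rewrite [X in X @ _ --> _](_ : _ = series (geometric A z)); last first.
  by apply/funext => n; rewrite /= sumEFin.
by apply: cvg_geometric_series; rewrite ger0_norm.
Qed.

(* Integrable over the line when [a < 1 < b], by comparison with a sum of
   multiples of indicators of dyadic intervals. *)
Definition profile (a b t : R) : R :=
  if `|t| <= 1 then `|t| `^ (- a) else `|t| `^ (- b).

Lemma profile_ge0 a b t : 0 <= profile a b t.
Proof. by rewrite /profile; case: ifP => _; exact: powR_ge0. Qed.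

Lemma measurable_profile a b x :
  measurable_fun [set: R] (fun t => profile a b (t - x)).
Proof.
have mn : measurable_fun [set: R] (fun t : R => `|t - x|).
  apply: measurableT_comp; first exact: normr_measurable.
  by apply: measurable_funB => //; exact: measurable_cst.
apply: measurable_fun_ifT.
- by apply: measurable_fun_ler => //; exact: measurable_cst.
- exact: (measurableT_comp (@measurable_powR R (- a)) mn).
- exact: (measurableT_comp (@measurable_powR R (- b)) mn).
Qed.

Lemma ler_powRN (a x y : R) : 0 <= a -> 0 < x -> x <= y -> y `^ (- a) <= x `^ (- a).
Proof.
move=> a0 x0 xy; have y0 := lt_le_trans x0 xy.
rewrite !powRN lef_pV2 ?posrE ?powR_gt0 //.
by apply: ge0_ler_powR => //; rewrite nnegrE ltW.
Qed.

Lemma gt1_ltr_powRr (x p q : R) : 1 < x -> p < q -> x `^ p < x `^ q.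
Proof.
move=> x1 pq; have x0 : x == 0 = false by rewrite gt_eqF //; lra.
by rewrite /powR x0 ltr_expR ltr_pM2r // ln_gt0.
Qed.

(** The least [m] with [2^-1 ^+ m < t] is positive because [t <= 1]; [k] is its predecessor. *)
Lemma dyadic_below (t : R) : 0 < t -> t <= 1 ->
  exists k, t <= 2^-1 ^+ k /\ 2^-1 ^+ k.+1 < t.
Proof.
move=> t0 t1.
have [m mt] : exists m, 2^-1 ^+ m < t.
  have : 2^-1 ^+ n @[n --> \oo] --> (0 : R).
    by apply: cvg_expr; rewrite ger0_norm; lra.
  move/cvgrPdist_lt => /(_ _ t0) [m _ /(_ m (leqnn m))] /=.
  by rewrite sub0r normrN ger0_norm ?exprn_ge0 // => h; exists m.
case: (ex_minnP (ex_intro (fun m => 2^-1 ^+ m < t) m mt)) => -[|k] hk kmin.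
  by move: hk; rewrite expr0 ltNge t1.
exists k; split => //; rewrite leNgt; apply/negP => /kmin.
by rewrite ltnn.
Qed.

Lemma dyadic_above (t : R) : 1 < t ->
  exists k, t <= 2 ^+ k.+1 /\ 2 ^+ k <= t.
Proof.
move=> t1.
have t0 : 0 < t^-1 by rewrite invr_gt0; lra.
have [|k [k1 k2]] := dyadic_below t0; first by rewrite invf_le1; lra.
have tp : t \is Num.pos by rewrite posrE; lra.
have pp m : (2 : R) ^+ m \is Num.pos by rewrite posrE exprn_gt0.
exists k; rewrite !exprVn in k1 k2.
rewrite lef_pV2 // in k1; rewrite ltf_pV2 // in k2.
by split => //; exact: ltW.
Qed.

Lemma powRX (x a : R) k : 0 <= x -> (x ^+ k) `^ a = (x `^ a) ^+ k.
Proof.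
by move=> x0; rewrite -(powR_mulrn k x0) -(powR_mulrn k (powR_ge0 x a)) powRAC.
Qed.

Lemma powR_inv2X (a : R) k : (2^-1 ^+ k) `^ (- a) = (2 `^ a) ^+ k.
Proof.
rewrite powRX; last by lra.
by rewrite -(powR_inv1 (ltW (ltr0Sn _ 1))) -powRrM mulN1r opprK.
Qed.

(** Splitting at distance 1 from [x] and cutting both pieces into dyadic shells gives geometric
    series of ratio 2^a / 2 inside and 2^(1 - b) outside; these are below 1 exactly when a < 1 and b
    > 1. *)
Lemma integral_profile_lty a b x : 0 <= a < 1 -> 1 < b ->
  (\int[mu]_(t in [set: R]) (profile a b (t - x))%:E < +oo)%E.
Proof.
move=> /andP[a0 a1] b1.
pose f1 t := if `|t - x| <= 1 then profile a b (t - x) else 0.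
pose f2 t := if `|t - x| <= 1 then 0 else profile a b (t - x).
have mn0 : measurable_fun [set: R] (fun t : R => `|t - x|).
  apply: measurableT_comp; first exact: normr_measurable.
  by apply: measurable_funB => //; exact: measurable_cst.
have mn : measurable_fun [set: R] (fun t : R => `|t - x| <= 1).
  by apply: measurable_fun_ler => //; exact: measurable_cst.
have mf1 : measurable_fun [set: R] f1.
  apply: measurable_fun_ifT => //; exact: measurable_profile.
have mf2 : measurable_fun [set: R] f2.
  apply: measurable_fun_ifT => //; exact: measurable_profile.
have f10 t : 0 <= f1 t by rewrite /f1; case: ifP => // _; exact: profile_ge0.
have f20 t : 0 <= f2 t by rewrite /f2; case: ifP => // _; exact: profile_ge0.
have -> : (\int[mu]_(t in [set: R]) (profile a b (t - x))%:E =
   \int[mu]_(t in [set: R]) ((f1 t)%:E + (f2 t)%:E))%E.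
  apply: eq_integral => t _; rewrite -EFinD /f1 /f2.
  by case: ifP; rewrite ?addr0 ?add0r.
rewrite ge0_integralD //; last 4 first.
- by move=> t _; rewrite lee_fin.
- exact/measurable_EFinP.
- by move=> t _; rewrite lee_fin.
- exact/measurable_EFinP.
have pow2 : 0 < 2 `^ a :> R by rewrite powR_gt0.
have pow2a : 2 `^ a < 2 :> R.
  by rewrite -[ltRHS]powRr1 //; apply: gt1_ltr_powRr => //; lra.
have pow2b : 2 `^ (- b) * 2 < 1 :> R.
  have -> : 2 `^ (- b) * 2 = 2 `^ (1 - b) :> R.
    rewrite addrC powRD; last by apply/implyP => _; rewrite gt_eqF.
    by rewrite powRr1.
  by rewrite -[ltRHS](powRr0 2); apply: gt1_ltr_powRr; lra.
apply: lte_add_pinfty.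
  (* On the shell between the radii 2^-(k+1) and 2^-k the power is at most its value at the inner
     radius, (2^a)^(k+1). *)
  apply: (@integral_layers_lty _ x (2 * 2 `^ a) (2 `^ a / 2)
    (fun k => (2 `^ a) ^+ k.+1) (fun k => 2^-1 ^+ k)) => //.
  - by apply/andP; split; lra.
  - by move=> k; rewrite exprMn exprS; ring.
  - move=> t; rewrite /f1 /profile; case: ifPn => tx; last by rewrite ltxx.
    move=> _; have [tx0|] := ltP 0 `|t - x|.
      have [k [k1 k2]] := dyadic_below tx0 tx.
      exists k; split => //; rewrite tx -powR_inv2X.
      by apply: ler_powRN => //; exact: ltW.
    (* The centre lies in no shell. The value there is the default 0, or 1 when [a] is 0, so layer 0
       covers it. *)
    rewrite normr_le0 => /eqP ->; exists 0%N; rewrite normr0 expr0 ler01; split => //.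
    rewrite expr1; have [->|an0] := eqVneq a 0; first by rewrite oppr0 !powRr0.
    by rewrite powR0 ?oppr_eq0 // ltW.
apply: (@integral_layers_lty _ x 4 (2 `^ (- b) * 2)
  (fun k => (2 `^ (- b)) ^+ k) (fun k => 2 ^+ k.+1)) => //.
- by rewrite mulr_ge0 ?powR_ge0.
- by move=> k; rewrite exprMn exprS; ring.
- move=> t; rewrite /f2 /profile; case: (leP `|t - x| 1) => tx; first by rewrite ltxx.
  move=> _; have [k [k1 k2]] := dyadic_above tx.
  exists k; split => //; rewrite -powRX //.
  by apply: ler_powRN => //; lra.
Qed.

End Profile.

(** * Positivity of the constant *)

Section GammaPositive.
Variable R : realType.
Local Notation mu := (@lebesgue_measure R).

(** For t <= 1 the product is at most 1. For t > 1 the power t^z is at most t^m for an integer m >=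
    z, and the exponential series gives t^m <= m! exp(t). *)
Lemma powR_expRN_le (z : R) : 0 <= z ->
  exists2 C, 0 < C & forall t : R, 0 < t -> t `^ z * expR (- t) <= C.
Proof.
move=> z0; pose m := (Num.bound z).+1.
have zm : z <= m%:R by rewrite ltW // (lt_le_trans (archi_boundP z0)) // ler_nat.
exists (1 + m`!%:R); first by rewrite addr_gt0 // ltr0n fact_gt0.
move=> t t0; rewrite expRN ler_pdivrMr ?expR_gt0 //.
have [t1|t1] := leP t 1.
  apply: (@le_trans _ _ 1).
    rewrite -[leRHS](congr1 (@^~ z) (@powR1 R)).
    by apply: ge0_ler_powR; rewrite ?nnegrE // ltW.
  rewrite mulrDl mul1r; apply: (@le_trans _ _ (expR t)).
    by rewrite -expR0 ler_expR ltW.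
  by rewrite lerDl mulr_ge0 // expR_ge0.
apply: (@le_trans _ _ (t ^+ m)).
  rewrite -(powR_mulrn m (ltW t0)); apply: ler_powR => //; exact: ltW.
apply: (@le_trans _ _ (m`!%:R * expR t)).
  rewrite -ler_pdivrMl ?ltr0n ?fact_gt0 // mulrC.
  by apply: le_trans (expR_ge1Dxn (Num.bound z) (ltW t0)); rewrite lerDr.
by rewrite ler_wpM2r ?expR_ge0 // lerDr.
Qed.

(** Since [fine] sends +oo to 0, the integral must be shown finite as well as positive. Finiteness
    comes from a multiple of [profile a 2]: the power dominates near 0, and the exponential beats
    t^(z+1) at infinity. Positivity comes from the interval [1, 2]. *)
Lemma Gamma_gt0 (z : R) : 0 < z -> 0 < Gamma z.
Proof.
move=> z0; rewrite /Gamma.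
pose a := Num.max 0 (1 - z).
have a01 : 0 <= a < 1.
  by rewrite /a le_max lexx /= gt_max ltr01 /=; lra.
have az : 1 - z <= a by rewrite /a le_max lexx orbT.
have a0 : 0 <= a by case/andP: a01.
pose f t : R := t `^ (z - 1) * expR (- t).
have f0 t : 0 <= f t by rewrite mulr_ge0 ?powR_ge0 ?expR_ge0.
have mf : measurable_fun [set: R] f.
  apply: measurable_funM; first exact: measurable_powR.
  apply: measurableT_comp; first exact: measurable_expR.
  exact: oppr_measurable.
have mD : measurable [set t : R | 0 < t].
  have -> : [set t : R | 0 < t] = `]0, +oo[%classic.
    by apply/seteqP; split => t /=; rewrite in_itv /= andbT.
  exact: measurable_itv.
have z1 : 0 <= z + 1 by lra.
have [C C0 hC] := powR_expRN_le z1.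
have fle t : 0 < t -> f t <= (1 + C) * profile a 2 (t - 0).
  move=> t0; rewrite subr0 /profile /f gtr0_norm //; case: ifPn => t1.
    rewrite -[leLHS]mulr1 mulrAC mulr1 [leRHS]mulrC; apply: ler_pM.
    - exact: powR_ge0.
    - exact: expR_ge0.
    - by rewrite -[z - 1]opprB; apply: ger_powR; [rewrite t0 t1|lra].
    - apply: (@le_trans _ _ 1); last by rewrite lerDl ltW.
      by rewrite -expR0 ler_expR; lra.
  rewrite powRN ler_pdivlMr ?powR_gt0 // mulrAC -powRD; last first.
    by apply/implyP => _; rewrite gt_eqF.
  have -> : z - 1 + 2 = z + 1 by ring.
  apply: (le_trans (hC t t0)); lra.
have If := @integral_profile_lty R a 2 0 a01 (ltr1n R 2).
have fin : (\int[mu]_(t in [set t : R | (0 < t)%R]) (f t)%:E < +oo)%E.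
  have mh : measurable_fun [set: R] (fun t => ((1 + C) * profile a 2 (t - 0))%:E).
    apply/measurable_EFinP/measurable_funM; first exact: measurable_cst.
    exact: measurable_profile.
  have le1 : (\int[mu]_(t in [set t : R | (0 < t)%R]) (f t)%:E <=
      \int[mu]_(t in [set t : R | (0 < t)%R]) ((1 + C) * profile a 2 (t - 0))%:E)%E.
    apply: ge0_le_integral => //.
    - by move=> t _; rewrite lee_fin.
    - by apply/measurable_funTS/measurable_EFinP.
    - exact: measurable_funTS.
  apply: (le_lt_trans le1).
  have le2 : (\int[mu]_(t in [set t : R | (0 < t)%R]) ((1 + C) * profile a 2 (t - 0))%:E
      <= \int[mu]_(t in [set: R]) ((1 + C) * profile a 2 (t - 0))%:E)%E.
    apply: ge0_subset_integral => //.
    by move=> t _; rewrite lee_fin mulr_ge0 ?profile_ge0 //; lra.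
  apply: (le_lt_trans le2).
  under eq_integral do rewrite EFinM.
  rewrite ge0_integralZl_EFin //.
  - by rewrite lte_mul_pinfty // ?lee_fin; lra.
  - by move=> t _; rewrite lee_fin profile_ge0.
  - by apply/measurable_EFinP; exact: measurable_profile.
  - lra.
have pos : (0 < \int[mu]_(t in [set t : R | (0 < t)%R]) (f t)%:E)%E.
  pose D : set R := `[1, 2]%classic.
  have mI : measurable D by exact: measurable_itv.
  (* t^(z-1) is monotone in a direction that depends on the sign of z - 1, so its minimum over
     [1, 2] is the smaller endpoint value; the exponential factor is smallest at 2. *)
  pose c : R := Num.min (1 `^ (z - 1)) (2 `^ (z - 1)) * expR (- 2).
  have c0 : 0 < c by rewrite mulr_gt0 ?expR_gt0 // lt_min !powR_gt0.
  have le1 : (\int[mu]_(t in D) (cst c%:E t) <= \int[mu]_(t in D) (f t)%:E)%E.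
    apply: ge0_le_integral => //.
    - by move=> t _; rewrite lee_fin ltW.
    - by apply/measurable_funTS/measurable_EFinP.
    - move=> t; rewrite /D /= in_itv /= => /andP[t1 t2]; rewrite lee_fin /f.
      apply: ler_pM; rewrite ?expR_ge0 ?ler_expR; try lra.
        by rewrite le_min !powR_ge0.
      rewrite ge_min; have [z1'|z1'] := leP 0 (z - 1).
        by rewrite ge0_ler_powR // nnegrE; lra.
      by rewrite orbC -[z - 1]opprK ler_powRN //; lra.
  have le2 : (\int[mu]_(t in D) (f t)%:E <=
      \int[mu]_(t in [set t : R | (0 < t)%R]) (f t)%:E)%E.
    apply: ge0_subset_integral => //.
    - by apply/measurable_funTS/measurable_EFinP.
    - by move=> t _; rewrite lee_fin.
    - by move=> t; rewrite /D /= in_itv /= => /andP[t1 t2]; lra.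
  apply: (lt_le_trans _ (le_trans le1 le2)).
  rewrite integral_cst // /D /= lebesgue_measure_itv /= lte_fin ltr1n.
  rewrite -EFinD -EFinM lte_fin.
  by rewrite mulr_gt0 //; lra.
by apply: fine_gt0; rewrite pos fin.
Qed.

Lemma CNs_gt0 (N : nat) (s : R) : 0 < s < 1 -> 0 < CNs N s.
Proof.
move=> /andP[s0 s1]; rewrite /CNs.
have G1 : 0 < Gamma (N%:R / 2 + s) by apply: Gamma_gt0; rewrite ltr_wpDl // divr_ge0.
have G2 : 0 < Gamma (1 - s) by apply: Gamma_gt0; lra.
by rewrite divr_gt0 // !mulr_gt0 // powR_gt0 // pi_gt0.
Qed.

End GammaPositive.

(** * Second derivatives at a critical point *)

Section Calculus.
Variables (R : realType) (N : nat).
Implicit Types (f : 'rV[R]_N -> R) (x y v : 'rV[R]_N).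

Lemma is_derive_line f x v (t : R) : derivable f (x + t *: v) v ->
  is_derive t 1 (fun t => f (x + t *: v)) (derive f (x + t *: v) v).
Proof.
move=> df.
have E : (fun h : R => h^-1 *: (((fun t => f (x + t *: v)) \o shift t) (h *: 1) -
    f (x + t *: v))) =
  (fun h : R => h^-1 *: ((f \o shift (x + t *: v)) (h *: v) - f (x + t *: v))).
  apply/funext => h /=; congr (_ *: (f _ - _)).
  by rewrite [h *: 1]mulr1 scalerDl addrCA.
by apply: DeriveDef; rewrite /derivable /derive E.
Qed.

(** If the second derivative were negative, the first derivative along the line, which vanishes at
    0, would be negative just to the right of 0, and the mean value theorem would produce a value
    below the minimum. *)
Lemma second_derivative_test f x v (r : R) : 0 < r ->
  (forall t, `|t| < r -> derivable f (x + t *: v) v) ->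
  derivable (fun y => derive f y v) x v ->
  (forall y, f x <= f y) ->
  derive f x v = 0 /\ 0 <= derive (fun y => derive f y v) x v.
Proof.
move=> r0 df d2f fmin.
pose phi (t : R) : R := f (x + t *: v).
pose psi (t : R) : R := derive f (x + t *: v) v.
have dphi (t : R) : `|t| < r -> is_derive t 1 phi (psi t).
  by move=> tr; apply: is_derive_line; exact: df.
have x0v : x + (0 : R) *: v = x by rewrite scale0r addr0.
have phi0 : phi 0 = f x by rewrite /phi x0v.
have psi0 : psi 0 = derive f x v by rewrite /psi x0v.
have grad0 : derive f x v = 0.
  have rr : - r <= r by lra.
  have := @derive1_at_min _ phi (- r) r 0 rr.
  case.
  - by move=> t; rewrite in_itv /= -ltr_norml => /dphi [].
  - by rewrite in_itv /=; apply/andP; split; lra.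
  - by move=> t _; rewrite phi0; exact: fmin.
  - move=> _; have [|_ ->] := dphi 0; first by rewrite normr0.
    by rewrite psi0.
split => //; rewrite leNgt; apply/negP => d2_lt0.
set d2 := derive _ x v in d2_lt0.
have dpsi : is_derive (0 : R) 1 psi d2.
  have := @is_derive_line (fun y => derive f y v) x v 0.
  rewrite x0v => /(_ d2f); exact.
have cpsi : h^-1 *: ((psi \o shift 0) (h *: 1) - psi 0) @[h --> 0^'] --> d2.
  by case: dpsi => + <-.
have : \forall h \near 0^', h^-1 *: ((psi \o shift 0) (h *: 1) - psi 0) < 0.
  exact: (cvgr_lt _ cpsi).
case/nbhs_ballP => e /= e0 he.
pose h := Num.min e r / 2.
have m0 : 0 < Num.min e r by rewrite lt_min e0 r0.
have h0 : 0 < h by rewrite divr_gt0.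
have hm : h < Num.min e r by rewrite ltr_pdivrMr // ltr_pMr // ltr1n.
have [he' hr] : h < e /\ h < r by apply/andP; rewrite -lt_min.
have psi_lt0 t : 0 < t -> t <= h -> psi t < 0.
  move=> t0 th.
  have := he t; rewrite /ball /= sub0r normrN gtr0_norm // => /(_ (le_lt_trans th he')).
  move=> /(_ (lt0r_neq0 t0)); rewrite addr0 [t *: 1]mulr1 psi0 grad0 subr0.
  by rewrite [_ *: _]/(_ * _) pmulr_rlt0 // invr_gt0.
have [||c] := @MVT _ phi psi 0 h h0.
- move=> t; rewrite in_itv /= => /andP[t0 th]; apply: dphi.
  by rewrite gtr0_norm //; lra.
- apply: derivable_within_continuous => t; rewrite in_itv /= => /andP[t0 th].
  by have [] := dphi t _; first by rewrite ger0_norm //; lra.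
rewrite in_itv /= => /andP[c0 ch] E.
have : phi h - phi 0 < 0 by rewrite E subr0 nmulr_rlt0 // psi_lt0 // ltW.
by rewrite phi0 subr_lt0 ltNge fmin.
Qed.

Lemma line_increment_le f x v (M d : R) :
  (forall t, `|t| <= `|d| -> derivable f (x + t *: v) v /\
     `|derive f (x + t *: v) v| <= M) ->
  `|f (x + d *: v) - f x| <= M * `|d|.
Proof.
move=> h; pose phi (t : R) : R := f (x + t *: v).
pose psi (t : R) : R := derive f (x + t *: v) v.
have dphi (t : R) : `|t| <= `|d| -> is_derive t 1 phi (psi t).
  by move=> /h[? _]; exact: is_derive_line.
have phi0 : f x = phi 0 by rewrite /phi scale0r addr0.
rewrite phi0 -/(phi d).
have [d0|d0] := leP 0 d.
  rewrite ger0_norm // in h dphi *.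
  have [||c] := @MVT_segment _ phi psi 0 d d0.
  - by move=> t; rewrite in_itv /= => /andP[t0 t1]; apply: dphi; rewrite ger0_norm; lra.
  - apply: derivable_within_continuous => t; rewrite in_itv /= => /andP[t0 t1].
    by have [] := dphi t _; first by rewrite ger0_norm; lra.
  rewrite in_itv /= => /andP[c0 cd] ->; rewrite subr0 normrM (ger0_norm d0).
  by rewrite ler_wpM2r // (h c _).2 // ger0_norm.
rewrite ltr0_norm // in h dphi *.
have [||c] := @MVT_segment _ phi psi d 0 (ltW d0).
- by move=> t; rewrite in_itv /= => /andP[t0 t1]; apply: dphi; rewrite ler0_norm; lra.
- apply: derivable_within_continuous => t; rewrite in_itv /= => /andP[t0 t1].
  by have [] := dphi t _; first by rewrite ler0_norm; lra.
rewrite in_itv /= => /andP[c0 cd] E; rewrite distrC E sub0r normrM normrN.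
rewrite (ltr0_norm d0) ler_wpM2r //; first lra.
by rewrite (h c _).2 // ler0_norm //; lra.
Qed.

(* Move from [x] to [y] one coordinate at a time. *)
Lemma partials_increment_le f x (M r : R) :
  (forall z i, `|z - x| <= r ->
     derivable f z (evec R i) /\ `|pderiv i f z| <= M) ->
  forall y, `|y - x| <= r -> `|f y - f x| <= N%:R * M * `|y - x|.
Proof.
move=> h y yr.
pose z k : 'rV[R]_N := \row_i (if (i < k)%N then y ord0 i else x ord0 i).
have z0 : z 0%N = x by apply/rowP => i; rewrite mxE.
have zN : z N = y by apply/rowP => i; rewrite mxE ltn_ord.
rewrite -{1}zN -{1}z0 -(telescope_sumr (fun k => f (z k)) (leq0n N)) big_mkord.
apply: (le_trans (ler_norm_sum _ _ _)).
apply: (@le_trans _ _ (\sum_(i < N) M * `|y - x|)); last first.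
  by rewrite sumr_const card_ord -mulrA mulr_natl.
apply: ler_sum => k _.
pose d := y ord0 k - x ord0 k.
have zS : z k.+1 = z k + d *: evec R k.
  apply/rowP => i; rewrite !mxE eqxx /= ltnS leq_eqVlt.
  have [->|ik] := eqVneq i k; first by rewrite eqxx ltnn /= mulr1 /d; ring.
  by rewrite -val_eqE /= in ik; rewrite (negbTE ik) /= mulr0 addr0.
have dyx : `|d| <= `|y - x|.
  by have := rvnorm_ge (y - x) k; rewrite !mxE.
(* Each coordinate of the difference from [x] is 0, [t] or a coordinate of [y - x], so the segment
   stays in the sup-norm ball. *)
have zx t : `|t| <= `|d| -> `|z k + t *: evec R k - x| <= r.
  move=> td; apply: le_trans yr; apply: rvnorm_le => // i.
  rewrite !mxE eqxx /=; have [->|ik] := eqVneq i k.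
    rewrite ltnn mulr1; have -> : x ord0 k + t - x ord0 k = t by ring.
    exact: le_trans dyx.
  rewrite mulr0 addr0; case: ifP => _; last by rewrite subrr normr0.
  by have := rvnorm_ge (y - x) i; rewrite !mxE.
rewrite zS; apply: (@le_trans _ _ (M * `|d|)).
  by apply: line_increment_le => t /zx; exact: h.
rewrite ler_wpM2l //; have [] := h x k; last by move=> _; apply: le_trans.
by rewrite subrr normr0; apply: le_trans yr.
Qed.

(** Second partials are bounded by some [M] near [x]. As the gradient vanishes at [x], the increment
    bound makes each first partial at most N M |y - x|; a second use of it, on [f], gives the
    quadratic estimate. *)
Lemma C2_critical_point_le (Om : set 'rV[R]_N) f x : open Om -> Om x ->
  C2_on Om f -> (forall i, pderiv i f x = 0) ->
  exists K d, [/\ 0 <= K, 0 < d &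
    forall y, `|y - x| <= d -> `|f y - f x| <= K * `|y - x| ^+ 2].
Proof.
move=> oOm Omx C2 grad0.
(* The sum dominates every second partial at [x] with a margin of 1, which continuity uses up on a
   neighbourhood. *)
pose M := \sum_(i < N) \sum_(j < N) (`|pderiv j (pderiv i f) x| + 1).
pose c i j := `|pderiv j (pderiv i f) x| + 1.
have c0 i j : 0 <= c i j by exact: addr_ge0.
have sum_ge (F : 'I_N -> R) k : (forall i, 0 <= F i) -> F k <= \sum_(i < N) F i.
  by move=> F0; rewrite (bigD1 k) //= lerDl sumr_ge0.
have M0 : 0 <= M by apply: sumr_ge0 => i _; apply: sumr_ge0 => j _; exact: c0.
have MP i j : `|pderiv j (pderiv i f) x| + 1 <= M.
  apply: (le_trans (sum_ge (c i) j (c0 i))).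
  apply: (sum_ge (fun i => \sum_(j < N) c i j)) => k.
  by apply: sumr_ge0 => l _; exact: c0.
have Omn : \forall y \near x, Om y by exact: open_nbhs_nbhs.
have Mn : \forall y \near x, forall i j, `|pderiv j (pderiv i f) y| <= M.
  apply: (@filter_forall _ _ (fun i y => forall j,
    `|pderiv j (pderiv i f) y| <= M) _ (nbhs_filter x)) => i.
  apply: (@filter_forall _ _ (fun j y =>
    `|pderiv j (pderiv i f) y| <= M) _ (nbhs_filter x)) => j.
  have [_ /(_ i j) [_ [_ [_ cij]]]] := C2 x Omx.
  have : \forall y \near x, `|pderiv j (pderiv i f) x - pderiv j (pderiv i f) y| < 1.
    by move/cvgrPdist_lt : cij; apply.
  apply: filterS => y hy; apply: le_trans (MP i j).
  move: hy; generalize (pderiv j (pderiv i f) x) (pderiv j (pderiv i f) y) => a b.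
  by have := ler_distD a b 0; rewrite !subr0 (distrC b a); lra.
have : \forall y \near x, Om y /\ forall i j, `|pderiv j (pderiv i f) y| <= M.
  exact: filterI Omn Mn.
case/nbhs_ballP => e /= e0 he.
pose d := e / 2.
have hd y : `|y - x| <= d -> Om y /\ forall i j, `|pderiv j (pderiv i f) y| <= M.
  move=> yd; apply: he; rewrite -ball_normE /ball_ /= distrC.
  by apply: (le_lt_trans yd); rewrite /d; lra.
have grad_le y i : `|y - x| <= d -> `|pderiv i f y| <= N%:R * M * `|y - x|.
  move=> yd; have := @partials_increment_le (pderiv i f) x M d _ y yd.
  rewrite grad0 subr0; apply => z j zd; have [Omz Mz] := hd z zd.
  by have [_ /(_ i j) [_ [_ [dij _]]]] := C2 z Omz.
exists (N%:R * (N%:R * M)), d; split => //; first by rewrite !mulr_ge0.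
  by rewrite /d; lra.
move=> y yd.
(* The radius is taken to be |y - x| itself, so that the gradient bound at the outer radius holds on
   the whole ball. *)
have := @partials_increment_le f x (N%:R * M * `|y - x|) `|y - x| _ y (lexx _).
rewrite expr2 !mulrA; apply => z i zy; have zd := le_trans zy yd.
have [Omz _] := hd z zd; have [_ /(_ i i) [dz _]] := C2 z Omz; split => //.
by apply: (le_trans (grad_le z i zd)); rewrite ler_wpM2l // mulr_ge0.
Qed.

End Calculus.

(** * The truncated singular integral *)

Section Kernel.
Variables (R : realType) (N : nat).
Local Notation mu := (@lebesgue_measure R).
Implicit Types (x y : 'rV[R]_N).

Lemma enorm_ge0 x : 0 <= enorm x.
Proof. exact: sqrtr_ge0. Qed.

Lemma coord_le_enorm x i : `|x ord0 i| <= enorm x.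
Proof.
rewrite -sqrtr_sqr /enorm; apply: ler_wsqrtr.
by rewrite (bigD1 i) //= lerDl sumr_ge0 // => j _; exact: sqr_ge0.
Qed.

Lemma norm_le_enorm x : `|x| <= enorm x.
Proof. by apply: rvnorm_le => [|i]; [exact: enorm_ge0|exact: coord_le_enorm]. Qed.

Lemma enorm_le_norm x : enorm x <= N%:R * `|x|.
Proof.
have n0 : 0 <= N%:R * `|x| by rewrite mulr_ge0.
rewrite -[leRHS]ger0_norm // -sqrtr_sqr /enorm; apply: ler_wsqrtr.
apply: (@le_trans _ _ (\sum_(i < N) `|x| ^+ 2)).
  apply: ler_sum => i _; rewrite -[leLHS]real_normK ?num_real //.
  by rewrite lerXn2r ?nnegrE //; exact: rvnorm_ge.
rewrite sumr_const card_ord exprMn -[leLHS]mulr_natl ler_wpM2r ?exprn_ge0 //.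
by rewrite -natrX ler_nat -mulnn; case: (N) => // k; rewrite leq_pmulr.
Qed.

Lemma enormB x y : enorm (x - y) = enorm (y - x).
Proof.
by rewrite /enorm; congr Num.sqrt; apply: eq_bigr => i _; rewrite !mxE -sqrrN opprB.
Qed.

Lemma measurable_enorm d (T : measurableType d) (c : 'I_N -> T -> R) :
  (forall i, measurable_fun [set: T] (c i)) ->
  measurable_fun [set: T] (fun t => enorm (\row_i c i t)).
Proof.
move=> mc; rewrite /enorm.
have msum : measurable_fun [set: T]
    (fun t => \sum_(i < N) (\row_i c i t) ord0 i ^+ 2).
  apply: measurable_sum => i; under eq_fun do rewrite mxE.
  exact: measurable_funX.
exact: (measurableT_comp (continuous_measurable_fun (@sqrt_continuous R)) msum).
Qed.

Lemma measurable_enormB x d (T : measurableType d) (c : 'I_N -> T -> R) :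
  (forall i, measurable_fun [set: T] (c i)) ->
  measurable_fun [set: T] (fun t => enorm (x - \row_i c i t)).
Proof.
move=> mc.
have E t : x - \row_i c i t = \row_i (x ord0 i - c i t).
  by apply/rowP => i; rewrite !mxE.
under eq_fun do rewrite E.
apply: (measurable_enorm (c := fun i t => x ord0 i - c i t)) => i.
by apply: measurable_funB => //; exact: measurable_cst.
Qed.

(** The integrand of [fraclap_trunc] with its sign reversed, hence nonnegative when [x] is a minimum
    point, as iterated integration requires. *)
Definition gap_kernel (p : R) (u : 'rV[R]_N -> R) x (eps : R) y : R :=
  if eps <= enorm (x - y) then (u y - u x) / enorm (x - y) `^ p else 0.

Lemma measurable_gap_kernel p (u : 'rV[R]_N -> R) x eps : continuous u ->
  rv_measurable (fun y => (gap_kernel p u x eps y)%:E).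
Proof.
move=> cu d T c mc; apply/measurable_EFinP.
have me := measurable_enormB x mc.
apply: measurable_fun_ifT.
- by apply: measurable_fun_ler => //; exact: measurable_cst.
- apply: measurable_funM.
    apply: measurable_funB; last exact: measurable_cst.
    exact: continuous_rv_measurable.
  under eq_fun do rewrite -powRN.
  exact: (measurableT_comp (@measurable_powR R (- p)) me).
- exact: measurable_cst.
Qed.

Lemma measurable_L1s_density p (u : 'rV[R]_N -> R) : continuous u ->
  rv_measurable (fun y => (`|u y| / (1 + enorm y `^ p))%:E).
Proof.
move=> cu d T c mc; apply/measurable_EFinP.
have mden : measurable_fun [set: T] (fun t => 1 + enorm (\row_i c i t) `^ p).
  apply: measurable_funD; first exact: measurable_cst.
  exact: (measurableT_comp (@measurable_powR R p) (measurable_enorm mc)).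
apply: measurable_funM.
  apply: measurableT_comp; first exact: normr_measurable.
  exact: continuous_rv_measurable.
under eq_fun => t.
  rewrite -powR_inv1; last by rewrite addr_ge0 // powR_ge0.
  over.
exact: (measurableT_comp (@measurable_powR R (- 1)) mden).
Qed.

Lemma rv_measurable_prod (c : R) (h : 'I_N -> R -> R) :
  (forall i, measurable_fun [set: R] (h i)) ->
  rv_measurable (fun y => (c * \prod_(i < N) h i (y ord0 i))%:E).
Proof.
move=> mh d T f mf; apply/measurable_EFinP.
apply: measurable_funM; first exact: measurable_cst.
apply: measurable_prod => i _; under eq_fun do rewrite mxE.
exact: (measurableT_comp (mh i) (mf i)).
Qed.

(** Both branches decrease in |t|, and across the junction they are compared with their common value
    1. The case t = 0 is excluded because a negative power of 0 defaults to 0. *)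
Lemma profile_le a b t e : 0 <= a -> 0 <= b -> 0 < `|t| -> `|t| <= e ->
  profile a b e <= profile a b t :> R.
Proof.
move=> a0 b0 t0 te; have e0 := lt_le_trans t0 te.
rewrite /profile (gtr0_norm e0).
have [e1|e1] := leP e 1.
  by rewrite (le_trans te e1) ler_powRN.
have [t1|t1] := leP `|t| 1; last exact: ler_powRN.
apply: (@le_trans _ _ 1).
  rewrite -[leRHS](congr1 (@^~ (- b)) (@powR1 R)).
  by apply: ler_powRN => //; exact: ltW.
rewrite -[leLHS](congr1 (@^~ (- a)) (@powR1 R)).
exact: ler_powRN.
Qed.

(** * An integrable majorant of the kernel, uniform in the truncation radius *)

Section Bound.
Variables (s : R) (u : 'rV[R]_N -> R) (x : 'rV[R]_N) (K d : R).
Hypotheses (N0 : (0 < N)%N) (s01 : 0 < s < 1) (K0 : 0 <= K) (d0 : 0 < d).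
Hypothesis (d1 : d <= 1).
Hypothesis u_quad : forall y, `|y - x| <= d -> `|u y - u x| <= K * `|y - x| ^+ 2.

Let n0 : 0 < N%:R :> R. Proof. by rewrite ltr0n. Qed.
Let p : R := N%:R + 2 * s.
(* [a] and [b] are chosen so that [profile a b e ^+ N] dominates [e^(2 - p)]
   for small [e] and [e^(- p)] for large [e]. *)
Let a : R := Num.max 0 (1 - 2 * (1 - s) / N%:R).
Let b : R := 1 + 2 * s / N%:R.

Let p0 : 0 < p. Proof. by case/andP: s01 => s0 s1; rewrite /p; have := n0; lra. Qed.

Let a01 : 0 <= a < 1.
Proof.
case/andP: s01 => s0 s1; rewrite /a le_max lexx /= gt_max ltr01 /=.
by rewrite ltrBlDr ltrDl divr_gt0 //; lra.
Qed.

Let b1 : 1 < b.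
Proof. by case/andP: s01 => s0 s1; rewrite /b ltrDl divr_gt0 //; lra. Qed.

Let Nb : b * N%:R = p.
Proof. by rewrite /b /p; field; rewrite gt_eqF. Qed.

Let Na : p - 2 <= a * N%:R.
Proof.
have -> : p - 2 = (1 - 2 * (1 - s) / N%:R) * N%:R by rewrite /p; field; rewrite gt_eqF.
by rewrite ler_wpM2r ?(ltW n0) // /a le_max lexx orbT.
Qed.

Let P y := \prod_(i < N) profile a b (y ord0 i - x ord0 i).

(** Every coordinate difference is at most the Euclidean distance and [profile] decreases, so each
    factor of [P y] is at least the radial value. *)
Let profile_prod y : (forall i, y ord0 i != x ord0 i) ->
  profile a b (enorm (x - y)) ^+ N <= P y.
Proof.
move=> yx; rewrite /P -[X in _ ^+ X]card_ord -prodr_const.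
apply: ler_prod => i _; rewrite profile_ge0 /=.
case/andP: a01 => a0 _; apply: profile_le => //.
- by apply: le_trans (ltW b1).
- by rewrite normr_gt0 subr_eq0.
- by rewrite enormB; have := coord_le_enorm (y - x) i; rewrite !mxE.
Qed.

Let near_le e : 0 < e -> e <= 1 -> e `^ (2 - p) <= profile a b e ^+ N.
Proof.
move=> e0 e1; rewrite /profile (gtr0_norm e0) e1 -(powR_mulrn N (powR_ge0 _ _)).
rewrite -powRrM; apply: ger_powR; first by rewrite e0.
by rewrite mulNr lerNl opprB.
Qed.

(** Between [d] and 1 the factor d^-2 pays for the missing square in [near_le]; beyond 1 the choice
    of [b] gives equality without that factor, which is at least 1 because [d <= 1]. *)
Let far_le e : d < e -> e `^ (- p) <= d ^- 2 * profile a b e ^+ N.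
Proof.
move=> de; have e0 := lt_trans d0 de.
have d2 : 0 < d ^- 2 by rewrite invr_gt0 exprn_gt0.
have [e1|e1] := leP e 1.
  have -> : e `^ (- p) = e ^- 2 * e `^ (2 - p).
    rewrite -(powR_invn 2 (ltW e0)) -powRD; last by apply/implyP => _; rewrite gt_eqF.
    by congr (_ `^ _); ring.
  apply: ler_pM => //; [by rewrite invr_ge0 exprn_ge0 // ltW|exact: powR_ge0| |].
    rewrite lef_pV2 ?posrE ?exprn_gt0 //.
    by rewrite lerXn2r ?nnegrE ?ltW.
  exact: near_le.
have E : profile a b e ^+ N = e `^ (- p).
  rewrite /profile (gtr0_norm e0) leNgt e1 /= -(powR_mulrn N (powR_ge0 _ _)).
  by rewrite -powRrM mulNr Nb.
rewrite E ler_peMl ?powR_ge0 // invf_ge1 ?exprn_gt0 //.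
by rewrite exprn_ile1 // ltW.
Qed.

(** For e = |x - y| > d, both |x| <= (|x| / d) e and |y| <= |x| + e in the sup norm, so [A] bounds
    the Euclidean norm of y by A e; the factor N converts between the norms. Then [C] adds the two
    bounds 1 <= d^-p e^p and |y|^p <= A^p e^p, which compares the kernel with the weight of [L1s]
    away from [x]. *)
Let A : R := N%:R * (1 + `|x| / d).
Let C : R := d `^ (- p) + A `^ p.

Let weight_le y : d < enorm (x - y) ->
  (enorm (x - y) `^ p)^-1 <= C / (1 + enorm y `^ p).
Proof.
move=> de; set e := enorm _ in de *; have e0 := lt_trans d0 de.
have ep : 0 < e `^ p by exact: powR_gt0.
have w0 : 0 < 1 + enorm y `^ p by rewrite ltr_pwDl // powR_ge0.
rewrite ler_pdivlMr // mulrC ler_pdivrMr // /C mulrDl.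
have A0 : 0 <= A by rewrite mulr_ge0 // addr_ge0 // divr_ge0 // ltW.
apply: lerD.
  rewrite powRN mulrC ler_pdivlMr ?powR_gt0 // mul1r.
  by apply: ge0_ler_powR; rewrite ?nnegrE ltW.
rewrite -powRM ?(ltW e0) //; apply: ge0_ler_powR; rewrite ?nnegrE ?enorm_ge0 ?(ltW p0) //.
  by rewrite mulr_ge0 // ltW.
apply: (le_trans (enorm_le_norm y)); rewrite /A -mulrA ler_wpM2l //.
have := norm_le_enorm (x - y); rewrite -/e => ne.
have : `|y| <= `|x| + `|x - y|.
  by have := ler_normB x (x - y); rewrite opprB addrCA subrr addr0.
have : `|x| <= `|x| / d * e by rewrite mulrAC ler_pdivlMr // ler_wpM2l // ltW.
by rewrite mulrDl mul1r; lra.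
Qed.

(** Within distance [d] the quadratic estimate leaves K e^(2 - p), controlled by [near_le]. Farther
    out the term in [u y] is absorbed by the weight of [L1s], and the constant [u x] by [far_le]. *)
Lemma gap_kernel_le eps y : 0 < eps -> (forall i, y ord0 i != x ord0 i) ->
  gap_kernel p u x eps y <=
  C * (`|u y| / (1 + enorm y `^ p)) + (K + `|u x| * d ^- 2) * P y.
Proof.
move=> eps0 yx.
have P0 : 0 <= P y by apply: prodr_ge0 => i _; exact: profile_ge0.
have C0 : 0 <= C by rewrite addr_ge0 ?powR_ge0.
have L0 : 0 <= `|u y| / (1 + enorm y `^ p) by rewrite divr_ge0 // addr_ge0 ?powR_ge0.
have D0 : 0 <= `|u x| * d ^- 2 by rewrite mulr_ge0 // invr_ge0 exprn_ge0 // ltW.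
rewrite /gap_kernel; case: ifPn => he; last first.
  by apply: addr_ge0; apply: mulr_ge0 => //; exact: addr_ge0.
have e0 := lt_le_trans eps0 he.
set e := enorm (x - y) in e0 he *.
have ep : 0 < e `^ p by exact: powR_gt0.
have [ed|ed] := leP e d.
  apply: (@le_trans _ _ (K * P y)); last first.
    by rewrite [(K + _) * _]mulrDl addrCA lerDl; apply: addr_ge0; exact: mulr_ge0.
  have ye : `|y - x| <= e by rewrite /e enormB norm_le_enorm.
  apply: (@le_trans _ _ (K * e ^+ 2 / e `^ p)).
    rewrite ler_wpM2r ?invr_ge0 ?(ltW ep) //.
    apply: (le_trans (ler_norm _)); apply: (le_trans (u_quad (le_trans ye ed))).
    by rewrite ler_wpM2l // lerXn2r ?nnegrE // ltW.
  rewrite -mulrA ler_wpM2l //; apply: le_trans (profile_prod yx).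
  have -> : e ^+ 2 / e `^ p = e `^ (2 - p).
    rewrite [RHS]powRD; last by apply/implyP => _; rewrite gt_eqF.
    by rewrite powRN (powR_mulrn 2 (ltW e0)).
  by apply: near_le => //; exact: le_trans d1.
have uu : u y - u x <= `|u y| + `|u x|.
  by apply: (le_trans (ler_norm _)); exact: ler_normB.
apply: (@le_trans _ _ ((`|u y| + `|u x|) / e `^ p)).
  by rewrite ler_wpM2r // invr_ge0 ltW.
rewrite mulrDl; apply: lerD.
  by rewrite mulrCA ler_wpM2l // weight_le.
apply: (@le_trans _ _ (`|u x| * d ^- 2 * P y)); last first.
  by rewrite ler_wpM2r // lerDr.
rewrite -mulrA ler_wpM2l // -powRN; apply: (le_trans (far_le ed)).
by rewrite ler_wpM2l ?profile_prod // invr_ge0 exprn_ge0 // ltW.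
Qed.

Lemma iint_gap_kernel_bounded : continuous u -> L1s s u -> (forall y, u x <= u y) ->
  exists B : R, forall eps, 0 < eps ->
    (iint (fun y => (gap_kernel p u x eps y)%:E) <= B%:E)%E.
Proof.
move=> cu Lu umin.
pose h i t : R := profile a b (t - x ord0 i).
have mh i : measurable_fun [set: R] (h i) by exact: measurable_profile.
have h0 i t : 0 <= h i t by exact: profile_ge0.
pose I i := fine (\int[mu]_(t in [set: R]) (h i t)%:E).
have hI i : (\int[mu]_(t in [set: R]) (h i t)%:E = (I i)%:E)%E.
  rewrite fineK // ge0_fin_numE; first exact: (integral_profile_lty _ a01 b1).
  by apply: integral_ge0 => t _; rewrite lee_fin.
pose g y : \bar R := (`|u y| / (1 + enorm y `^ p))%:E.
pose c := K + `|u x| * d ^- 2.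
have c0 : 0 <= c by rewrite addr_ge0 // mulr_ge0 // invr_ge0 exprn_ge0 // ltW.
have C0 : 0 <= C by rewrite addr_ge0 ?powR_ge0.
have g0 y : (0 <= g y)%E by rewrite lee_fin divr_ge0 // addr_ge0 ?powR_ge0.
have mg : rv_measurable g by exact: measurable_L1s_density.
pose q y : \bar R := (c * \prod_(i < N) h i (y ord0 i))%:E.
have q0 y : (0 <= q y)%E by rewrite lee_fin mulr_ge0 // prodr_ge0.
have mq : rv_measurable q by exact: rv_measurable_prod.
have Cg0 y : (0 <= C%:E * g y)%E by rewrite mule_ge0 // lee_fin.
have mCg : rv_measurable (fun y => C%:E * g y)%E.
  by move=> d' T f mf; apply: measurable_funeM; exact: mg.
have fin : (iint g < +oo)%E by exact: Lu.
have fing : (iint g \is a fin_num)%E by rewrite ge0_fin_numE // iint_ge0.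
exists (C * fine (iint g) + c * \prod_(i < N) I i) => eps eps0.
have k0 y : (0 <= (gap_kernel p u x eps y)%:E)%E.
  rewrite lee_fin /gap_kernel; case: ifP => // _.
  by rewrite divr_ge0 ?powR_ge0 // subr_ge0.
rewrite EFinD EFinM fineK // -(iint_prod c0 mh h0 hI) -iintZl // -iintD //.
apply: (@iint_le _ _ x) => //.
- exact: measurable_gap_kernel.
- by move=> d' T f mf; apply: emeasurable_funD; [exact: mCg|exact: mq].
- by move=> y; apply: adde_ge0; [exact: Cg0|exact: q0].
- by move=> y yx; rewrite /g /q -EFinM -EFinD lee_fin gap_kernel_le.
Qed.

End Bound.

End Kernel.

(** * Sign of the fractional Laplacian at a minimum point *)

Section MinimumPoint.
Variables (R : realType) (N : nat).
Local Notation mu := (@lebesgue_measure R).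

Lemma iint_eq0 n : iint (fun _ : 'rV[R]_n => 0%E) = 0%E :> \bar R.
Proof. by elim: n => [|n IH] //=; apply: integral0_eq => t _; exact: IH. Qed.

Lemma rn_integral_npos n (g : 'rV[R]_n -> R) : (forall y, g y <= 0) ->
  rn_integral g = - fine (iint (fun y => (- g y)%:E)).
Proof.
move=> g0; rewrite /rn_integral.
have -> : (fun y => (Num.max (g y) 0)%:E) = (fun=> 0%E).
  by apply/funext => y; rewrite max_r.
have -> : (fun y => (Num.max (- g y) 0)%:E) = (fun y => (- g y)%:E).
  by apply/funext => y; rewrite max_l // oppr_ge0.
by rewrite iint_eq0 /= sub0r.
Qed.

Variables (s : R) (u : 'rV[R]_N -> R) (x : 'rV[R]_N).
Hypotheses (N0 : (0 < N)%N) (s01 : 0 < s < 1).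
Hypotheses (cu : continuous u) (umin : forall y, u x <= u y).
Let p : R := N%:R + 2 * s.

Lemma gap_kernel_ge0 eps y : 0 <= gap_kernel p u x eps y.
Proof.
by rewrite /gap_kernel; case: ifP => // _; rewrite divr_ge0 ?powR_ge0 // subr_ge0.
Qed.

Lemma fraclap_truncE eps :
  fraclap_trunc s u x eps = - fine (iint (fun y => (gap_kernel p u x eps y)%:E)).
Proof.
have E y : (if eps <= enorm (x - y) then (u x - u y) / enorm (x - y) `^ p else 0)
    = - gap_kernel p u x eps y.
  by rewrite /gap_kernel; case: ifP; rewrite ?oppr0 // -mulNr opprB.
rewrite /fraclap_trunc rn_integral_npos => [|y]; last first.
  by rewrite E oppr_le0 gap_kernel_ge0.
by congr (- fine (iint _)); apply/funext => y; rewrite E opprK.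
Qed.

Lemma iint_gap_kernel_homo eps1 eps2 : eps1 <= eps2 ->
  (iint (fun y => (gap_kernel p u x eps2 y)%:E) <=
   iint (fun y => (gap_kernel p u x eps1 y)%:E))%E.
Proof.
move=> e12; apply: (@iint_le _ _ x); try exact: measurable_gap_kernel.
- by move=> y; rewrite lee_fin gap_kernel_ge0.
- by move=> y; rewrite lee_fin gap_kernel_ge0.
move=> y _; rewrite lee_fin {1}/gap_kernel; case: ifPn => h; last exact: gap_kernel_ge0.
by rewrite /gap_kernel (le_trans e12 h).
Qed.

(** By continuity the gap stays above half its value at [z] on a small cube around [z]; the integral
    is at least the volume of that cube times a positive lower bound of the kernel there. *)
Lemma iint_gap_kernel_gt0 z : u x < u z ->
  exists g eps0, [/\ 0 < g, 0 < eps0 &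
    (g%:E <= iint (fun y => (gap_kernel p u x eps0 y)%:E))%E].
Proof.
move=> xz; pose m := (u z - u x) / 2.
have m0 : 0 < m by rewrite divr_gt0 // subr_gt0.
have zx : z != x by apply/eqP => E; move: xz; rewrite E ltxx.
pose rho := `|x - z|.
have rho0 : 0 < rho by rewrite normr_gt0 subr_eq0 eq_sym.
have : \forall y \near z, m < u y - u x.
  have /cvgrPdist_lt /(_ m m0) := @cu z.
  apply: filterS => y hy; have := ler_norm (u z - u y).
  by move: hy; rewrite /m; lra.
case/nbhs_ballP => r1 /= r10 hr1.
(* Halving keeps the closed cube inside the ball of radius [r1] and at distance at least rho / 2
   from [x], hence in the region kept by the truncation at rho / 2. *)
pose r := Num.min r1 rho / 2.
have r0 : 0 < r by rewrite divr_gt0 // lt_min r10.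
have rr1 : r < r1.
  have : Num.min r1 rho <= r1 by rewrite ge_min lexx.
  by rewrite /r; lra.
have rrho : r <= rho / 2 by rewrite /r ler_wpM2r // ge_min lexx orbT.
(* An upper bound for the Euclidean distance from [x] to the cube's points, whose sup distance is at
   most rho + r. *)
pose E := N%:R * (2 * rho).
have n0 : 0 < N%:R :> R by rewrite ltr0n.
have E0 : 0 < E by rewrite mulr_gt0 // mulr_gt0.
have Ep : 0 < E `^ p by exact: powR_gt0.
pose B i : set R := `[z ord0 i - r, z ord0 i + r]%classic.
have mB i : measurable (B i) by exact: measurable_itv.
pose h i (t : R) : R := \1_(B i) t.
have mh i : measurable_fun [set: R] (h i) by apply: measurable_indic; exact: mB.
have h0 i t : 0 <= h i t by rewrite /h indicE.
have hI i : (\int[mu]_(t in [set: R]) (h i t)%:E = (2 * r)%:E)%E.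
  rewrite integral_indic; [|exact: measurableT|exact: mB].
  rewrite setIT /B /= lebesgue_measure_itv /= lte_fin ifT; last lra.
  by rewrite -EFinD; congr (_%:E); ring.
have c0 : 0 <= m / E `^ p by rewrite divr_ge0 // ltW.
exists (m / E `^ p * \prod_(i < N) (2 * r)), (rho / 2); split.
- by apply: mulr_gt0; [exact: divr_gt0|apply: prodr_gt0 => i _; lra].
- by rewrite divr_gt0.
rewrite -(iint_prod c0 mh h0 hI); apply: (@iint_le _ _ x).
- exact: rv_measurable_prod.
- exact: measurable_gap_kernel.
- by move=> y; rewrite lee_fin mulr_ge0 // prodr_ge0.
- by move=> y; rewrite lee_fin gap_kernel_ge0.
move=> y _; rewrite lee_fin.
have [yB|] := pselect (forall i, B i (y ord0 i)); last first.
  move=> /existsNP[i yi]; rewrite (bigD1 i) //= {1}/h indicE memNset // mul0r mulr0.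
  exact: gap_kernel_ge0.
rewrite big1 ?mulr1; last by move=> i _; rewrite /h indicE mem_set.
have yz : `|y - z| <= r.
  apply: rvnorm_le => [|i]; first exact: ltW.
  rewrite !mxE; have := yB i; rewrite /B /= in_itv /= => /andP[y1 y2].
  by rewrite ler_norml; apply/andP; split; lra.
have uy : m < u y - u x.
  by apply: hr1; rewrite -ball_normE /ball_ /= distrC; exact: le_lt_trans rr1.
have xy1 : rho <= `|x - y| + r.
  by have := ler_distD y x z; rewrite /rho; lra.
have xy2 : `|x - y| <= rho + r.
  by have := ler_distD z x y; rewrite (distrC z y) /rho; lra.
have e1 : rho / 2 <= enorm (x - y).
  by apply: le_trans (norm_le_enorm _); lra.
rewrite /gap_kernel e1; have e0 : 0 < enorm (x - y) by apply: lt_le_trans e1; lra.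
apply: ler_pM; [exact: ltW|by rewrite invr_ge0 powR_ge0|exact: ltW|].
rewrite lef_pV2 ?posrE ?powR_gt0 //; apply: ge0_ler_powR.
- by case/andP: s01 => s0 s1; rewrite /p; lra.
- by rewrite nnegrE ltW.
- by rewrite nnegrE ltW.
by apply: (le_trans (enorm_le_norm _)); rewrite ler_wpM2l // ?ltW //; lra.
Qed.

(** The truncations are monotone in the radius and bounded below, so the limit really exists and
    [lim] is not a default value; below [eps0] they are all at most [- g], and so is the limit. *)
Lemma fraclap_lt0 z (Om : set 'rV[R]_N) : open Om -> Om x -> C2_on Om u ->
  (forall i, pderiv i u x = 0) -> L1s s u -> u x < u z -> fraclap s u x < 0.
Proof.
move=> oOm Omx C2 grad0 Lu xz.
have [K [d [K0 d0 quad]]] := C2_critical_point_le oOm Omx C2 grad0.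
(* The radius is cut down to 1 because the majorant is built for [d <= 1]. *)
have d'0 : 0 < Num.min d 1 by rewrite lt_min d0 ltr01.
have d'1 : Num.min d 1 <= 1 by rewrite ge_min lexx orbT.
have quad' y : `|y - x| <= Num.min d 1 -> `|u y - u x| <= K * `|y - x| ^+ 2.
  by rewrite le_min => /andP[/quad].
have [B hB] := iint_gap_kernel_bounded N0 s01 K0 d'0 d'1 quad' (@cu) Lu (@umin).
rewrite -/p in hB.
have [g [eps0 [g0 eps00 hg]]] := iint_gap_kernel_gt0 xz.
pose G eps := iint (fun y => (gap_kernel p u x eps y)%:E).
have G0 eps : (0 <= G eps)%E.
  by apply: iint_ge0 => y; rewrite lee_fin gap_kernel_ge0.
have Gfin eps : 0 < eps -> (G eps \is a fin_num)%E.
  by move=> e0; rewrite ge0_fin_numE // (le_lt_trans (hB _ e0)) // ltry.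
have cvT : cvg (fraclap_trunc s u x eps @[eps --> 0^'+]).
  apply: (@nondecreasing_at_right_is_cvgr).
    near=> b; move=> e1 e2; rewrite !in_itv /= => /andP[e10 _] /andP[e20 _] e12.
    rewrite !fraclap_truncE lerN2; apply: fine_le; try exact: Gfin.
    exact: iint_gap_kernel_homo.
  near=> b; exists (- B); move=> w [e /=]; rewrite in_itv /= => /andP[e0 _] <-.
  by rewrite fraclap_truncE lerN2 -lee_fin fineK ?hB //; exact: Gfin.
rewrite /fraclap pmulr_rlt0 ?CNs_gt0 //.
apply: (@le_lt_trans _ _ (- g)); last by rewrite oppr_lt0.
apply: limr_le => //; near=> e.
have e0 : 0 < e by near: e; exact: nbhs_right_gt.
have ee0 : e <= eps0 by near: e; exact: nbhs_right_le.
rewrite fraclap_truncE lerN2 -lee_fin fineK; last exact: Gfin.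
exact: (le_trans hg (iint_gap_kernel_homo ee0)).
Unshelve. all: by end_near. Qed.

End MinimumPoint.

(** * An interior minimum point, and constancy of the solution *)

Theorem theorem3p1 (R : realType) (N : nat) (Om : set 'rV[R]_N)
  (q : 'rV[R]_N -> 'rV[R]_N) (s : R) (u : 'rV[R]_N -> R) :
  (0 < N)%N ->
  open Om -> ebounded Om ->
  Linfty_on Om q ->
  0 < s < 1 ->
  L1s s u -> C2_on Om u -> continuous u ->
  (forall x, Om x -> 0 <= - laplacian u x + fraclap s u x + qdotgrad q u x) ->
  (forall x, ~ Om x -> 0 <= u x) ->
  (forall x, Om x -> 0 < u x) \/ (forall x, u x = 0).
Proof.
move=> N0 oOm [M OmM] _ s01 Lu C2 cu sup u_out.
have [|/existsNP[x1 /not_implyP[Omx1 /negP]]] := pselect (forall x, Om x -> 0 < u x).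
  by left.
rewrite -leNgt => ux1; right.
(* A minimum over a closed ball containing [Om] exists by compactness; being at most 0, it is global
   since [u] is nonnegative off [Om]. *)
have [x [Omx ux umin]] : exists x, [/\ Om x, u x <= 0 & forall y, u x <= u y].
  pose A : set 'rV[R]_N := closed_ball_ (fun y => `|y|) 0 M.
  have AE y : A y <-> `|y| <= M by rewrite /A /closed_ball_ /= sub0r normrN.
  have Om_A y : Om y -> A y.
    by move=> /OmM yM; apply/AE; exact: le_trans (norm_le_enorm _) yM.
  have cA : compact A.
    apply: bounded_closed_compact; last exact: closed_closed_ball_.
    exists M; split; first exact: num_real.
    by move=> k Mk y /AE yM; apply: le_trans yM (ltW Mk).
  have [x0 x0A x0min] := @EVT_min_rV R N u A (ex_intro _ x1 (Om_A _ Omx1)) cA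
    (continuous_subspaceT cu).
  have umin0 y : A y -> u x0 <= u y by move=> yA; apply: x0min; exact: mem_set.
  have x0le : u x0 <= 0 by apply: le_trans ux1; apply: umin0; exact: Om_A.
  have umin y : u x0 <= u y.
    have [Omy|nOmy] := pselect (Om y); first by apply: umin0; exact: Om_A.
    exact: le_trans (u_out y nOmy).
  have [Omx0|nOmx0] := pselect (Om x0); first by exists x0.
  (* A minimizer outside [Om] forces the minimum value 0, so [x1], where [u] is at most 0, is itself
     a minimizer and lies in [Om]. *)
  have ux0 : u x0 = 0 by apply/eqP; rewrite eq_le x0le u_out.
  by exists x1; split => // y; apply: (le_trans ux1); rewrite -ux0.
have crit i : pderiv i u x = 0 /\ 0 <= pderiv i (pderiv i u) x.
  have : \forall y \near x, Om y by exact: open_nbhs_nbhs.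
  case/nbhs_ballP => r /= r0 hr.
  apply: (second_derivative_test r0) => //.
    move=> t tr; have Omt : Om (x + t *: evec R i).
      apply: hr; rewrite -ball_normE /ball_ /= opprD addrA subrr sub0r normrN.
      apply: le_lt_trans tr; apply: rvnorm_le => // j; rewrite !mxE eqxx /=.
      by case: (j == i); rewrite ?mulr1 // mulr0 normr0.
    by have [_ /(_ i i) []] := C2 _ Omt.
  by have [_ /(_ i i) [_ [_ []]]] := C2 _ Omx.
have const y : u y = u x.
  apply/eqP; rewrite eq_le umin andbT leNgt; apply/negP => xy.
  have grad0 i : pderiv i u x = 0 by have [] := crit i.
  have := fraclap_lt0 N0 s01 (@cu) umin oOm Omx C2 grad0 Lu xy.
  have lap : 0 <= laplacian u x by apply: sumr_ge0 => i _; have [] := crit i.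
  have drift : qdotgrad q u x = 0.
    by rewrite /qdotgrad big1 // => i _; rewrite grad0 mulr0.
  by have := sup x Omx; rewrite drift; lra.
(* A constant vector with entries beyond the bound [M] leaves [Om]; a coordinate to test exists
   because N > 0. *)
have [y nOmy] : exists y, ~ Om y.
  exists (const_mx (`|M| + 1)) => /OmM.
  have := coord_le_enorm (const_mx (`|M| + 1) : 'rV[R]_N) (Ordinal N0).
  rewrite mxE ger0_norm ?addr_ge0 //; have := ler_norm M; lra.
move=> w; rewrite const; apply/eqP; rewrite eq_le ux /=.
by rewrite -(const y); exact: u_out.
Qed.
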